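(* Let $n\ge 1$ and let $\mathbb{F}_q$ be a finite field. For every coadjoint cluster $\Psi$ in $\mathfrak{u}^*(n,\mathbb{F}_q)$ and every $g\in U(n,\mathbb{F}_q)$, $$\chi(\Psi)(g)=\frac{\deg\chi(\Psi)}{|\Psi|}\cdot\sum_{\lambda\in\Psi}\theta[\lambda(g-I)].$$
   Context: $U(n,\mathbb{F}_q)$ is the group of upper triangular unipotent $n\times n$ matrices over $\mathbb{F}_q$, $\mathfrak{u}(n,\mathbb{F}_q)$ is the algebra of upper triangular nilpotent (strictly upper triangular) matrices, and $\mathfrak{u}^*(n,\mathbb{F}_q)$ is its $\mathbb{F}_q$-linear dual. For $g\in U(n,\mathbb{F}_q)$ and $\lambda\in\mathfrak{u}^*(n,\mathbb{F}_q)$ define $(g*\lambda)(X)=\lambda(Xg)$ (left action) and $(\lambda*g)(X)=\lambda(gX)$ (right action); these commute. The coadjoint cluster of $\lambda$ is $\Psi(\lambda)=\{g*\lambda*g' : g,g'\in U(n,\mathbb{F}_q)\}$. Fix a non-trivial homomorphism $\theta$ from the additive group of $\mathbb{F}_q$ to the multiplicative group $\mathbb{C}^\times$. Let $\mathbb{C}[U(n,\mathbb{F}_q)]$ be the space of complex-valued functions on $U(n,\mathbb{F}_q)$, carrying the regular representation $(g*v)(g')=v(g'g)$, and put $v(\lambda)(g)=\theta[\lambda(g-I)]$. For $\lambda\in\mathfrak{u}^*(n,\mathbb{F}_q)$, the span $V(\lambda)$ of $\{v(\mu): \mu=g*\lambda,\ g\in U(n,\mathbb{F}_q)\}$ is a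 submodule of the regular representation, called a cluster module; its character $\chi(\lambda)$ is called a cluster character. It depends only on the coadjoint cluster $\Psi$ of $\lambda$, and one writes $\chi(\Psi)=\chi(\lambda)$. $\deg\chi(\Psi)=\chi(\Psi)(I)$ is its degree. *)

(* Defs.v *)
From HB Require Import structures.
From mathcomp Require Import all_boot all_order all_algebra all_fingroup all_field.
From mathcomp Require Import reals complex.
Set Implicit Arguments.
Unset Strict Implicit.
Unset Printing Implicit Defensive.
Import GRing.Theory.
Local Open Scope ring_scope.

Section Unitriangular.
Variables (n : nat) (F : finFieldType).

Definition is_unitriangular (A : 'M[F]_n) : bool :=
  [forall i, A i i == 1] &&
  [forall i : 'I_n, forall j : 'I_n, (j < i)%N ==> (A i j == 0)].

Lemma is_unitriangularP (A : 'M[F]_n) :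
  reflect ((forall i, A i i = 1) /\ (forall i j : 'I_n, (j < i)%N -> A i j = 0))
          (is_unitriangular A).
Proof.
apply: (iffP andP) => [[/forallP d /forallP l]|[d l]]; split.
- by move=> i; apply/eqP.
- by move=> i j lt_ji; apply/eqP; move/forallP/(_ j)/implyP: (l i); apply.
- by apply/forallP=> i; rewrite d.
- by apply/forallP=> i; apply/forallP=> j; apply/implyP=> /l->.
Qed.

Record unitri := Unitri { mx_of_unitri :> 'M[F]_n; _ : is_unitriangular mx_of_unitri }.

HB.instance Definition _ := [isSub for mx_of_unitri].
HB.instance Definition _ := [Finite of unitri by <:].

Lemma unitri_diag (g : unitri) i : g i i = 1.
Proof. by case: g => A hA /=; have [] := is_unitriangularP _ hA. Qed.

Lemma unitri_low (g : unitri) (i j : 'I_n) : (j < i)%N -> g i j = 0.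
Proof. by case: g => A hA /=; have [_] := is_unitriangularP _ hA; apply. Qed.

Lemma unitri1_subproof : is_unitriangular 1%:M.
Proof.
apply/is_unitriangularP; split=> [i|i j lt_ji]; rewrite mxE ?eqxx //.
by case: eqP lt_ji => // ->; rewrite ltnn.
Qed.
Definition unitri1 := Unitri unitri1_subproof.

Lemma unitriM_subproof (g h : unitri) : is_unitriangular (g *m h).
Proof.
apply/is_unitriangularP; split=> [i|i j lt_ji]; rewrite mxE.
  rewrite (bigD1 i) //= !unitri_diag mulr1 big1 ?addr0 // => k.
  rewrite neq_ltn => /orP[lt|lt]; first by rewrite (unitri_low g lt) mul0r.
  by rewrite (unitri_low h lt) mulr0.
apply: big1 => k _; case: (ltnP k i) => [lt|le_ik].
  by rewrite (unitri_low g lt) mul0r.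
by rewrite (unitri_low h (leq_trans lt_ji le_ik)) mulr0.
Qed.
Definition unitriM (g h : unitri) := Unitri (unitriM_subproof g h).

Lemma unitri_unitmx (g : unitri) : (g : 'M_n) \in unitmx.
Proof.
rewrite unitmxE -det_tr det_trig ?big1 ?unitr1 // => [i _|].
  by rewrite mxE unitri_diag.
by apply/is_trig_mxP=> i j lt_ij; rewrite mxE (unitri_low g lt_ij).
Qed.

Lemma unitriV_subproof (g : unitri) : is_unitriangular (invmx g).
Proof.
have injg : injective (unitriM g).
  move=> h k /(congr1 mx_of_unitri)/= /(congr1 (mulmx (invmx g))).
  by rewrite !mulKmx ?unitri_unitmx // => /val_inj.
have /(congr1 mx_of_unitri)/= E := f_invF injg unitri1.
suff -> : invmx g = invF injg unitri1 by case: (invF _ _).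
by rewrite -[RHS](mulKmx (unitri_unitmx g)) E mulmx1.
Qed.
Definition unitriV (g : unitri) := Unitri (unitriV_subproof g).

Lemma unitriMA : associative unitriM.
Proof. by move=> g h k; apply: val_inj; rewrite /= mulmxA. Qed.
Lemma unitri1M : left_id unitri1 unitriM.
Proof. by move=> g; apply: val_inj; rewrite /= mul1mx. Qed.
Lemma unitriVM : left_inverse unitri1 unitriV unitriM.
Proof. by move=> g; apply: val_inj; rewrite /= mulVmx ?unitri_unitmx. Qed.

HB.instance Definition _ := Finite_isGroup.Build unitri unitriMA unitri1M unitriVM.

Definition lower_part (A : 'M[F]_n) : 'M[F]_n :=
  \matrix_(i, j) (if (i < j)%N then 0 else A i j).

Lemma lower_part_linear : linear lower_part.
Proof.
move=> a A B; apply/matrixP=> i j; rewrite !mxE.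
by case: ifP; rewrite ?mulr0 ?addr0.
Qed.
HB.instance Definition _ :=
  GRing.isLinear.Build F 'M[F]_n 'M[F]_n _ lower_part lower_part_linear.

(* The strictly upper triangular matrices, see [mem_uspace]. *)
Definition uspace : {vspace 'M[F]_n} := lker (linfun lower_part).

Lemma mem_uspace (A : 'M[F]_n) :
  reflect (forall i j : 'I_n, (j <= i)%N -> A i j = 0) (A \in uspace).
Proof.
rewrite memv_ker lfunE /=; apply: (iffP eqP) => [/matrixP E i j le_ji|E].
  by have := E i j; rewrite !mxE ltnNge le_ji.
by apply/matrixP=> i j; rewrite !mxE; case: ltnP => // /E->.
Qed.

Definition ualg := subvs_of uspace.

Lemma ualg_low (X : ualg) (i j : 'I_n) : (j <= i)%N -> vsval X i j = 0.
Proof. by move=> le_ji; apply: (mem_uspace _ (subvsP X)). Qed.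

Lemma ualg_mulr_subproof (X : ualg) (g : unitri) : vsval X *m g \in uspace.
Proof.
apply/mem_uspace=> i j le_ji; rewrite mxE big1 // => k _.
case: (leqP k i) => [le|lt]; first by rewrite ualg_low ?mul0r.
by rewrite (unitri_low g (leq_ltn_trans le_ji lt)) mulr0.
Qed.
Definition ualg_mulr (g : unitri) (X : ualg) : ualg := Subvs (ualg_mulr_subproof X g).

Lemma ualg_mull_subproof (g : unitri) (X : ualg) : g *m vsval X \in uspace.
Proof.
apply/mem_uspace=> i j le_ji; rewrite mxE big1 // => k _.
case: (ltnP k i) => [lt|le]; first by rewrite (unitri_low g lt) mul0r.
by rewrite ualg_low ?mulr0 // (leq_trans le_ji le).
Qed.
Definition ualg_mull (g : unitri) (X : ualg) : ualg := Subvs (ualg_mull_subproof g X).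

Lemma unitri_sub1_subproof (g : unitri) : (g : 'M_n) - 1%:M \in uspace.
Proof.
apply/mem_uspace=> i j; rewrite leq_eqVlt !mxE => /orP[/eqP/val_inj->|lt].
  by rewrite unitri_diag eqxx subrr.
rewrite (unitri_low g lt); case: eqP lt => [->|_ _]; first by rewrite ltnn.
by rewrite subr0.
Qed.
Definition unitri_sub1 (g : unitri) : ualg := Subvs (unitri_sub1_subproof g).

Lemma ualg_mulr_linear g : linear (ualg_mulr g).
Proof. by move=> a X Y; apply: val_inj; rewrite /= mulmxDl scalemxAl. Qed.
HB.instance Definition _ g :=
  GRing.isLinear.Build F ualg ualg _ (ualg_mulr g) (ualg_mulr_linear g).

Lemma ualg_mull_linear g : linear (ualg_mull g).
Proof. by move=> a X Y; apply: val_inj; rewrite /= mulmxDr scalemxAr. Qed.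
HB.instance Definition _ g :=
  GRing.isLinear.Build F ualg ualg _ (ualg_mull g) (ualg_mull_linear g).

(* [finvect_type] only adds the finite type structure to the linear dual. *)
Definition udual := finvect_type 'Hom(ualg, F^o).
HB.instance Definition _ := Finite.on udual.

Definition udual_app (lam : udual) (X : ualg) : F := (lam : 'Hom(ualg, F^o)) X.

Definition lact (g : unitri) (lam : udual) : udual :=
  ((lam : 'Hom(ualg, F^o)) \o linfun (ualg_mulr g))%VF.
Definition ract (lam : udual) (g : unitri) : udual :=
  ((lam : 'Hom(ualg, F^o)) \o linfun (ualg_mull g))%VF.

Lemma lactE g lam X : udual_app (lact g lam) X = udual_app lam (ualg_mulr g X).
Proof. by rewrite /udual_app comp_lfunE lfunE. Qed.

Lemma ractE lam g X : udual_app (ract lam g) X = udual_app lam (ualg_mull g X).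
Proof. by rewrite /udual_app comp_lfunE lfunE. Qed.

Lemma lact_ract g lam h : ract (lact g lam) h = lact g (ract lam h).
Proof.
apply/lfunP=> X; rewrite -[LHS]/(udual_app _ X) -[RHS]/(udual_app _ X).
rewrite ractE !lactE ractE; congr udual_app.
by apply: val_inj; rewrite /= mulmxA.
Qed.

Lemma lactM g h lam : lact (g * h)%g lam = lact g (lact h lam).
Proof.
apply/lfunP=> X; rewrite -[LHS]/(udual_app _ X) -[RHS]/(udual_app _ X).
by rewrite !lactE; congr udual_app; apply: val_inj; rewrite /= mulmxA.
Qed.

Definition cluster (lam : udual) : {set udual} :=
  [set ract (lact gh.1 lam) gh.2 | gh : unitri * unitri].

Definition is_cluster (Psi : {set udual}) : Prop := exists lam, Psi = cluster lam.

Section ClusterModule.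
Variables (C : fieldType) (theta : F -> C).

Definition cfunsp := {ffun unitri -> C^o}.

Definition regact (g : unitri) (v : cfunsp) : cfunsp := [ffun x => v (x * g)%g].

Lemma regact_linear g : linear (regact g).
Proof. by move=> a u v; apply/ffunP=> x; rewrite !ffunE. Qed.
HB.instance Definition _ g :=
  GRing.isLinear.Build C cfunsp cfunsp _ (regact g) (regact_linear g).

Lemma regactM g h v : regact (g * h)%g v = regact g (regact h v).
Proof. by apply/ffunP=> x; rewrite !ffunE mulgA. Qed.

Definition vfun (lam : udual) : cfunsp :=
  [ffun g => theta (udual_app lam (unitri_sub1 g))].

Definition cluster_module (lam : udual) : {vspace cfunsp} :=
  <<[seq vfun (lact g lam) | g : unitri]>>%VS.

Lemma regact_vfun (g : unitri) (lam : udual) :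
  {morph theta : x y / x + y >-> x * y} ->
  regact g (vfun lam) = vfun lam g *: vfun (lact g lam).
Proof.
move=> thM; apply/ffunP=> x; rewrite !ffunE lactE -[RHS]/(_ * _) -thM.
congr theta.
transitivity (udual_app lam (unitri_sub1 g + ualg_mulr g (unitri_sub1 x))).
  congr udual_app; apply: val_inj.
  by rewrite /= mulmxBl mul1mx [RHS]addrC subrKA.
exact: (linearD (lam : 'Hom(ualg, F^o))).
Qed.

Lemma cluster_module_stable (g : unitri) (lam : udual) :
  {morph theta : x y / x + y >-> x * y} ->
  {in cluster_module lam, forall v, regact g v \in cluster_module lam}.
Proof.
move=> thM v Vv.
have -> : regact g v = linfun (regact g) v by rewrite lfunE.
have sub : (linfun (regact g) @: cluster_module lam <= cluster_module lam)%VS.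
  rewrite limg_span; apply/span_subvP=> _ /mapP[_ /imageP[h _ ->] ->].
  rewrite lfunE /= regact_vfun // -lactM; apply/memvZ/memv_span.
  exact/image_f.
by apply: (subvP sub); apply: memv_img.
Qed.

(* The matrix entries are the coordinates of [f] applied to a basis of [V]; this
   is the trace of the restriction of [f] whenever [f] stabilises [V]. *)
Definition trace_on (V : {vspace cfunsp}) (f : cfunsp -> cfunsp) : C :=
  \tr (\matrix_(i, j < \dim V) coord (vbasis V) i (f (vbasis V)`_j)).

Definition cluster_char (lam : udual) (g : unitri) : C :=
  trace_on (cluster_module lam) (regact g).

End ClusterModule.
End Unitriangular.

(* Main.v *)
From HB Require Import structures.
From mathcomp Require Import all_boot all_order all_algebra all_fingroup all_field.
From mathcomp Require Import reals complex.
Require Import Defs.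
Local Open Scope ring_scope.
Set Implicit Arguments.
Unset Strict Implicit.
Import GRing.Theory Num.Theory.

(** Write [U] for the unitriangular group and [u] for the strictly upper
    triangular matrices, so that [x |-> x - 1] is a bijection from [U] to [u].
    The functions [vfun theta mu] are, through this bijection, the characters of
    the additive group [u] ([sum_theta]), pairwise orthogonal and hence
    independent. The cluster module of [lam] has as basis those with [mu] in the
    left orbit [U lam], and [g] in [U] maps [vfun theta mu] to a multiple of
    [vfun theta (lact g mu)] with coefficient [theta (mu (g - 1))]. Its trace is
    thus the sum of [theta (mu (g - 1))] over the [mu] in [U lam] fixed by [g]
    ([cluster_char_fixed]); in particular the degree is the size of [U lam].

    The restriction to fixed points is removed by averaging over right
    translates: the average over [h] of [theta ((ract mu h) (g - 1))] is
    [theta (mu (g - 1))] if [g] fixes [mu] and 0 otherwise, because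
    [h (g - 1) = (g - 1) + (h - 1) (g - 1)] and [h - 1] runs over all of [u]
    ([sum_ract_theta]). Hence the character at [g] is the size of [U lam] times
    the average of [theta ((a lam h) (g - 1))] over all pairs [(a, h)]. As the
    cluster is the orbit of [lam] under [U * U], that average is also the average
    of [theta (mu (g - 1))] over the [mu] in the cluster
    ([sum_orbit_average]). *)

(** * Averages over orbits and traces *)

(** Averaging [f] over the translates of the orbit changes nothing, and the
    average of [f] over the translates of a single point of the orbit does not
    depend on the point. Comparing the two evaluates the sum over the orbit
    without any reference to stabilizers. *)
Lemma sum_orbit_average (K : pzRingType) (gT : finGroupType) (T : finType)
    (act : gT -> T -> T) (x : T) (f : T -> K) :
    (forall y, act 1%g y = y) ->
    (forall a b y, act (a * b)%g y = act a (act b y)) ->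
  #|gT|%:R * \sum_(y in [set act a x | a : gT]) f y =
  #|[set act a x | a : gT]|%:R * \sum_a f (act a x).
Proof.
move=> act1 actM; set O := [set _ | _ : _].
have actK a : cancel (act a) (act a^-1%g) by move=> y; rewrite -actM mulVg.
have actO a y : (act a y \in O) = (y \in O).
  have sub b z : z \in O -> act b z \in O.
    by case/imsetP=> c _ ->; rewrite -actM imset_f.
  by apply/idP/idP=> [/(sub a^-1%g)|/sub//]; rewrite actK.
transitivity (\sum_(a : gT) \sum_(y in O) f (act a y)).
  rewrite mulr_natl -sumr_const; apply: eq_bigr => a _.
  rewrite [LHS](reindex_inj (can_inj (actK a))).
  by apply: eq_bigl => y; rewrite actO.
rewrite exchange_big /= mulr_natl -sumr_const; apply: eq_bigr => y.
case/imsetP=> b _ ->; rewrite [RHS](reindex_inj (mulIg b)).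
by apply: eq_bigr => a _; rewrite actM.
Qed.

(** The trace of an endomorphism of [V] factored as a sum of rank-one maps
    [w |-> l i w *: f (v i)] is the sum of the [l i (f (v i))]. Only the
    reconstruction formula is assumed, so the trace can be read off a natural
    indexed spanning family rather than the arbitrary basis [vbasis V]. *)
Lemma trace_dual_frame (K : fieldType) (vT : vectType K) (V : {vspace vT})
    (I : finType) (O : {pred I}) (v : I -> vT) (l : I -> {linear vT -> K^o})
    (f : {linear vT -> vT}) :
    {in V, forall w, f w \in V} -> {in O, forall i, v i \in V} ->
    {in V, forall w, w = \sum_(i in O) l i w *: v i} ->
  \sum_(i < \dim V) coord (vbasis V) i (f (vbasis V)`_i) =
  \sum_(i in O) l i (f (v i)).
Proof.
move=> fV vV frame.
transitivity (\sum_(i < \dim V) \sum_(j in O)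
    coord (vbasis V) i (f (v j)) * l j (vbasis V)`_i).
  apply: eq_bigr => i _.
  have Vi : (vbasis V)`_i \in V by rewrite vbasis_mem // mem_nth ?size_tuple.
  rewrite {1}[(vbasis V)`_i]frame // !linear_sum; apply: eq_bigr => j _.
  by rewrite !linearZ mulrC.
rewrite exchange_big; apply: eq_bigr => j Oj.
rewrite {2}(coord_vbasis (fV _ (vV _ Oj))) linear_sum.
by apply: eq_bigr => i _; rewrite linearZ.
Qed.

(** * The two-sided action on linear forms *)

Section Characters.
Variables (n : nat) (F : finFieldType).
Implicit Types (g h a x : unitri n F) (lam mu nu : udual n F).

Lemma udual_appB lam mu X :
  udual_app (lam - mu : udual n F) X = udual_app lam X - udual_app mu X.
Proof. by rewrite /udual_app add_lfunE opp_lfunE. Qed.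

Lemma udual_appD lam X Y :
  udual_app lam (X + Y) = udual_app lam X + udual_app lam Y.
Proof. exact: (linearD (lam : 'Hom(ualg n F, F^o))). Qed.

Lemma udual_appZ lam c X : udual_app lam (c *: X) = c * udual_app lam X.
Proof. by rewrite /udual_app linearZ. Qed.

Lemma udual_eqP lam mu : (forall X, udual_app lam X = udual_app mu X) -> lam = mu.
Proof. by move=> E; apply/lfunP. Qed.

Lemma lact1 lam : lact 1%g lam = lam.
Proof.
apply: udual_eqP => X; rewrite lactE; congr udual_app.
by apply: val_inj; rewrite /= mulmx1.
Qed.

Lemma ractM lam g h : ract lam (g * h)%g = ract (ract lam g) h.
Proof.
apply: udual_eqP => X; rewrite !ractE; congr udual_app.
by apply: val_inj; rewrite /= mulmxA.
Qed.

Lemma ract1 lam : ract lam 1%g = lam.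
Proof.
apply: udual_eqP => X; rewrite ractE; congr udual_app.
by apply: val_inj; rewrite /= mul1mx.
Qed.

(** Translation by [X] on [U = 1 + u]: sums over the vector space of strictly
    upper triangular matrices are written here as sums over [x] in the group,
    through [x - 1], and this is the translation they are invariant under. *)
Lemma unitri_shift_subproof x (X : ualg n F) :
  is_unitriangular ((x : 'M_n) + vsval X).
Proof.
apply/is_unitriangularP; split=> [i|i j lt_ji]; rewrite mxE.
  by rewrite unitri_diag ualg_low // addr0.
by rewrite (unitri_low x) // ualg_low 1?ltnW // addr0.
Qed.
Definition unitri_shift (X : ualg n F) x := Unitri (unitri_shift_subproof x X).

Lemma unitri_shift_inj X : injective (unitri_shift X).
Proof. by move=> x y /(congr1 (@mx_of_unitri n F)) /addIr /val_inj. Qed.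

Lemma unitri_sub1_shift X x : unitri_sub1 (unitri_shift X x) = unitri_sub1 x + X.
Proof. by apply: val_inj; rewrite /= addrAC. Qed.

Lemma cluster_eq lam mu : mu \in cluster lam -> cluster lam = cluster mu.
Proof.
have sub nu nu' : nu' \in cluster nu -> cluster nu' \subset cluster nu.
  case/imsetP=> -[b k] _ ->; apply/subsetP=> _ /imsetP[[a h] _ ->] /=.
  by apply/imsetP; exists (a * b, k * h)%g; rewrite //= lactM ractM -lact_ract.
move=> lam_mu; apply/eqP; rewrite eqEsubset !sub //.
case/imsetP: lam_mu => -[a h] _ ->; apply/imsetP; exists (a^-1, h^-1)%g => //=.
by rewrite -lact_ract -ractM -lactM mulgV mulVg lact1 ract1.
Qed.

(** * Characters of the additive group of strictly upper triangular matrices *)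

Section Theta.
Variables (C : numFieldType) (theta : F -> C).
Hypothesis theta_neq0 : forall t, theta t != 0.
Hypothesis thetaD : {morph theta : s t / s + t >-> s * t}.
Hypothesis theta_nontriv : exists t, theta t != 1.

Lemma theta0 : theta 0 = 1.
Proof. by apply: (mulfI (theta_neq0 0)); rewrite -thetaD addr0 mulr1. Qed.

Lemma card_unitri_neq0 : #|{: unitri n F}|%:R != 0 :> C.
Proof. by rewrite pnatr_eq0 -lt0n; apply/card_gt0P; exists 1%g. Qed.

(** A non-zero linear form composed with [theta] is a non-trivial additive
    character, and translating by an element where it is not 1 kills its sum. *)
Lemma sum_theta lam :
  \sum_x theta (udual_app lam (unitri_sub1 x)) =
  if lam == 0 then #|{: unitri n F}|%:R else 0.
Proof.
case: eqP => [->|/eqP lam_neq0].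
  rewrite (eq_bigr (fun=> 1)) ?sumr_const // => x _.
  by rewrite /udual_app zero_lfunE theta0.
have [X lamX] : exists X, theta (udual_app lam X) != 1.
  have [t theta_t] := theta_nontriv.
  have [X lamX_neq0] : exists X, udual_app lam X != 0.
    (* The finite copy of the space of matrices makes the search decidable. *)
    case: (pickP (fun X : finvect_type (ualg n F) => udual_app lam X != 0)).
      by move=> X lamX; exists X.
    move=> lamX0; case/eqP: lam_neq0; apply: udual_eqP => X.
    by rewrite [RHS]zero_lfunE; apply/eqP/negbFE/lamX0.
  (* Rescaling makes the value of the form equal to [t]. *)
  by exists ((t / udual_app lam X) *: X); rewrite udual_appZ divfK.
set S := \sum_x _; have : theta (udual_app lam X) * S = S.
  rewrite mulr_sumr [RHS](reindex_inj (@unitri_shift_inj X)).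
  by apply: eq_bigr => x _; rewrite unitri_sub1_shift udual_appD thetaD mulrC.
move/eqP; rewrite -[X in _ == X]mul1r -subr_eq0 -mulrBl mulf_eq0 subr_eq0.
by rewrite (negPf lamX) => /eqP.
Qed.

(** The Fourier coefficient at [mu]: since the functions [vfun theta mu] are
    orthogonal characters of the additive group of strictly upper triangular
    matrices, it picks out the coordinate at [vfun theta mu]. *)
Definition fourier mu (w : cfunsp n F C) : C^o :=
  #|{: unitri n F}|%:R^-1 *
  \sum_x w x / theta (udual_app mu (unitri_sub1 x)).

Lemma fourier_linear mu : linear (fourier mu).
Proof.
move=> c w w'; rewrite -[RHS]/(c * _ + _) /fourier mulrCA -mulrDr; congr (_ * _).
rewrite mulr_sumr -big_split; apply: eq_bigr => x _.
by rewrite !ffunE mulrDl mulrA.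
Qed.
HB.instance Definition _ mu :=
  GRing.isLinear.Build C (cfunsp n F C) C^o _ (fourier mu) (fourier_linear mu).

Lemma fourierZ mu c w : fourier mu (c *: w) = c * fourier mu w.
Proof. by rewrite linearZ. Qed.

Lemma fourier_vfun mu nu : fourier mu (vfun theta nu) = (nu == mu)%:R.
Proof.
rewrite /fourier (eq_bigr (fun x =>
  theta (udual_app (nu - mu : udual n F) (unitri_sub1 x)))) => [|x _].
  rewrite sum_theta subr_eq0.
  by case: eqP => _; rewrite ?mulr0 // mulVf // card_unitri_neq0.
rewrite ffunE udual_appB; apply: (canLR (mulfK _)) => //.
by rewrite -thetaD subrK.
Qed.

(** * Cluster characters as sums over fixed points *)

Definition left_orbit lam : {set udual n F} := [set lact a lam | a : unitri n F].

Definition fixed_theta g mu : C :=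
  if lact g mu == mu then theta (udual_app mu (unitri_sub1 g)) else 0.

(** In the basis of the [vfun theta mu], [mu] in the left orbit, [g] acts by a
    monomial matrix, so that only the [mu] fixed by [g] contribute to the trace. *)
Lemma cluster_char_fixed lam g :
  cluster_char theta lam g = \sum_(mu in left_orbit lam) fixed_theta g mu.
Proof.
have vfunV : {in left_orbit lam, forall mu,
    vfun theta mu \in cluster_module theta lam}.
  by move=> _ /imsetP[a _ ->]; apply/memv_span/image_f.
have frame : {in cluster_module theta lam, forall w,
    w = \sum_(mu in left_orbit lam) fourier mu w *: vfun theta mu}.
  pose gens := [seq vfun theta (lact a lam) | a : unitri n F].
  have frame_gen v : v \in gens ->
      v = \sum_(mu in left_orbit lam) fourier mu v *: vfun theta mu.
    case/imageP=> a _ ->.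
    rewrite (bigD1 (lact a lam)) /=; last by apply/imsetP; exists a.
    rewrite fourier_vfun eqxx scale1r big1 ?addr0 // => mu /andP[_ neq_mu].
    by rewrite fourier_vfun eq_sym (negPf neq_mu) scale0r.
  move=> w w_V; have w_gens := @coord_span _ _ _ (in_tuple gens) w w_V.
  transitivity (\sum_(mu in left_orbit lam) \sum_(i < size gens)
      fourier mu (coord (in_tuple gens) i w *: gens`_i) *: vfun theta mu).
    rewrite {1}w_gens exchange_big; apply: eq_bigr => i _.
    rewrite {1}(frame_gen _ (mem_nth 0 (ltn_ord i))) scaler_sumr.
    by apply: eq_bigr => mu _; rewrite [LHS]scalerA -fourierZ.
  by apply: eq_bigr => mu _; rewrite [in RHS]w_gens linear_sum scaler_suml.
rewrite /cluster_char /trace_on /mxtrace.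
under eq_bigr do rewrite mxE.
rewrite (trace_dual_frame (l := fourier) _ vfunV frame); last first.
  exact: cluster_module_stable.
apply: eq_bigr => mu _; rewrite /= regact_vfun // fourierZ fourier_vfun ffunE.
rewrite /fixed_theta.
by case: eqP => _; rewrite ?mulr1 ?mulr0.
Qed.

Lemma cluster_char1 lam : cluster_char theta lam 1%g = #|left_orbit lam|%:R.
Proof.
rewrite cluster_char_fixed -sumr_const; apply: eq_bigr => mu _.
rewrite /fixed_theta lact1 eqxx.
have -> : unitri_sub1 (1%g : unitri n F) = 0 by apply: val_inj; rewrite /= subrr.
by rewrite /udual_app linear0 theta0.
Qed.

(** Expanding [h (g - 1) = (g - 1) + (h - 1) (g - 1)] shows that the summand is a
    constant times [theta] at the value of the form [lact g mu - mu] on [h - 1].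
    By [sum_theta] the sum over [h] therefore vanishes unless [g] fixes [mu]:
    averaging over right translates is what detects fixed points. *)
Lemma sum_ract_theta mu g :
  \sum_h theta (udual_app (ract mu h) (unitri_sub1 g)) =
  #|{: unitri n F}|%:R * fixed_theta g mu.
Proof.
transitivity (\sum_h theta (udual_app mu (unitri_sub1 g)) *
    theta (udual_app (lact g mu - mu : udual n F) (unitri_sub1 h))).
  apply: eq_bigr => h _; rewrite -thetaD ractE udual_appB lactE.
  congr theta; apply/eqP; rewrite addrA eq_sym subr_eq -!udual_appD.
  apply/eqP; congr udual_app; apply: val_inj => /=.
  by rewrite mulmxBl mulmxBr mul1mx mulmx1 addrC !addrA !subrK.
rewrite -mulr_sumr sum_theta subr_eq0 /fixed_theta.
by case: eqP => _; rewrite ?mulr0 // mulrC.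
Qed.

Lemma sum_left_orbit lam (f : udual n F -> C) :
  #|{: unitri n F}|%:R * \sum_(mu in left_orbit lam) f mu =
  #|left_orbit lam|%:R * \sum_a f (lact a lam).
Proof.
exact: sum_orbit_average lact1 (@lactM n F).
Qed.

Lemma sum_cluster lam (f : udual n F -> C) :
  #|{: unitri n F}|%:R ^+ 2 * \sum_(mu in cluster lam) f mu =
  #|cluster lam|%:R * \sum_a \sum_h f (ract (lact a lam) h).
Proof.
(* Inverting the right factor turns the two commuting actions into a left one. *)
pose act (ah : unitri n F * unitri n F) mu := ract (lact ah.1 mu) ah.2^-1%g.
have actM ah bk mu : act (ah * bk)%g mu = act ah (act bk mu).
  by rewrite /act /= invMg ractM lactM -!lact_ract.
have act1 mu : act 1%g mu = mu by rewrite /act /= invg1 lact1 ract1.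
have clusterE : cluster lam = [set act ah lam | ah : unitri n F * unitri n F].
  apply/setP=> mu; apply/imsetP/imsetP=> -[[a h] _ ->];
    by exists (a, h^-1)%g; rewrite /act ?invgK.
have := sum_orbit_average lam f act1 actM.
rewrite -clusterE card_prod natrM -expr2 => ->; congr (_ * _).
under [RHS]eq_bigr do rewrite (reindex_inj invg_inj).
by rewrite pair_bigA.
Qed.

End Theta.
End Characters.

Theorem theorem2p5 (R : realType) (n : nat) (n_ge1 : (1 <= n)%N) (F : finFieldType)
  (theta : F -> R[i])
  (theta_neq0 : forall x, theta x != 0)
  (theta_hom : forall x y, theta (x + y) = theta x * theta y)
  (theta_nontriv : exists x, theta x != 1)
  (Psi : {set udual n F}) (Psi_cluster : is_cluster Psi)
  (lam : udual n F) (lam_Psi : lam \in Psi) (g : unitri n F) :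
  cluster_char theta lam g =
    cluster_char theta lam 1%g / #|Psi|%:R *
      \sum_(mu in Psi) theta (udual_app mu (unitri_sub1 g)).
Proof.
have {Psi_cluster} -> : Psi = cluster lam.
  by case: Psi_cluster lam_Psi => nu -> /cluster_eq.
(* Both sides are [#|left_orbit lam|] times the average over [a] of
   [fixed_theta g (lact a lam)]. *)
have G_neq0 : #|{: unitri n F}|%:R != 0 :> R[i] := card_unitri_neq0 _ _ _.
have Psi_neq0 : #|cluster lam|%:R != 0 :> R[i].
  rewrite pnatr_eq0 -lt0n; apply/card_gt0P; exists lam.
  by apply/imsetP; exists (1, 1)%g; rewrite //= lact1 ract1.
rewrite (cluster_char1 theta_neq0) // (cluster_char_fixed theta_neq0) //.
apply: (mulfI G_neq0); rewrite sum_left_orbit -mulrA [RHS]mulrCA; congr (_ * _).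
apply: (mulfI G_neq0); apply: (mulfI Psi_neq0).
transitivity (#|cluster lam|%:R * \sum_a \sum_h
    theta (udual_app (ract (lact a lam) h) (unitri_sub1 g))).
  rewrite mulr_sumr; congr (_ * _); apply: eq_bigr => a _.
  by rewrite (sum_ract_theta theta_neq0).
rewrite -(sum_cluster lam (fun mu => theta (udual_app mu (unitri_sub1 g)))).
rewrite expr2 -mulrA [RHS]mulrCA; congr (_ * _).
by rewrite [RHS]mulrCA mulVKf.
Qed.
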